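(* Every integer $n>7$ with $n\notin\{11,14,17\}$ can be written as $n=x+y+2z$ with $x,y,z$ positive integers such that $x^2+y^2+2z^2$ is a perfect square.
   Context: A perfect square means the square of an integer. *)

(* Defs.v *)
From Stdlib Require Export ZArith.

Definition perfect_square (a : Z) : Prop := exists m : Z, a = (m ^ 2)%Z.

(* Main.v *)
Require Import Defs.
From Stdlib Require Import ZArith.
From Stdlib Require Import Lia Bool List.
Import ListNotations.
Open Scope Z_scope.

(** Put s = x + y - 2z and d = x - y. Then
    4 (x^2 + y^2 + 2 z^2) = n^2 + s^2 + 2 d^2, so the task is to find s and d,
    subject to congruences and to bounds expressing x, y, z > 0, for which
    n^2 + s^2 + 2 d^2 = (2w)^2 ([solvable_of_ternary]).

    Rewrite this as n^2 + 2 d^2 = (2w - s) (2w + s). The left side is the norm of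
    n + d sqrt(-2), so a factorization
    n + d sqrt(-2) = (a + sqrt(-2)) (c + e sqrt(-2)), that is n = ac - 2e and
    d = ae + c, splits it as A B with A = a^2 + 2 and B = c^2 + 2 e^2, and one takes
    4w = A + B and 2s = B - A or A - B. Positivity demands that A and B be close
    and that d be small, i.e. that n be close to a product of two nearby numbers
    a and c. Writing a, c = u -+ v, this means approximating n by u^2 - v^2:
    take u just above the square root of n, and v next to the square root of
    u^2 - n. Then v = O(sqrt u) and |e| <= v, so s and d are O(u^(3/2)), while n is
    about u^2 ([solvable_of_near_difference_of_squares]). The parities of u and v are
    chosen so that all the divisions by 2 and 4 are exact, which is possible for
    every odd n; this settles all odd n >= 41^2 ([solvable_large_odd]).

    Solutions scale: a solution for m gives one for p m. This reduces even n to
    n / 2, and it also thins out the finite range n < 41^2, where a search finishes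
    the proof ([solvable_small]). *)

(** * Solvability and the associated ternary form *)

Definition solvable (n : Z) : Prop :=
  exists x y z : Z,
    x > 0 /\ y > 0 /\ z > 0 /\
    n = x + y + 2 * z /\
    perfect_square (x ^ 2 + y ^ 2 + 2 * z ^ 2).

Lemma solvable_scale (p m : Z) : p > 0 -> solvable m -> solvable (p * m).
Proof.
  intros Hp (x & y & z & Hx & Hy & Hz & -> & w & Hw).
  exists (p * x), (p * y), (p * z).
  split; [nia |]. split; [nia |]. split; [nia |]. split; [ring |].
  exists (p * w).
  replace ((p * w) ^ 2) with (p ^ 2 * w ^ 2) by ring.
  rewrite <- Hw; ring.
Qed.

(** The solution is x = (n+s+2d)/4, y = (n+s-2d)/4, z = (n-s)/4; the two
    inequalities say exactly that these are positive. *)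
Lemma solvable_of_ternary (n s d w : Z) :
  n ^ 2 + s ^ 2 + 2 * d ^ 2 = 4 * w ^ 2 ->
  (4 | n - s) -> (4 | n + s + 2 * d) ->
  s < n -> 2 * Z.abs d < n + s ->
  solvable n.
Proof.
  intros Hw [z Hz] [x Hx] Hs Hd.
  exists x, (x - d), z.
  split; [lia |]. split; [lia |]. split; [lia |]. split; [lia |].
  exists w.
  assert (En : n = 2 * x + 2 * z - d) by lia.
  assert (Es : s = 2 * x - 2 * z - d) by lia.
  assert (E : n ^ 2 + s ^ 2 + 2 * d ^ 2 = 4 * (x ^ 2 + (x - d) ^ 2 + 2 * z ^ 2))
    by (rewrite En, Es; ring).
  apply (Z.mul_reg_l _ _ 4); [lia |].
  rewrite <- E; exact Hw.
Qed.

(** * Large odd numbers *)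

(** With a = u - v and c = u + v one has (B - A)/2 = 2uv + e^2 - 1. The
    congruence s = n mod 4 forces s = (B - A)/2 when n = 3 mod 4 (u even) and
    s = (A - B)/2 when n = 1 mod 4 (u odd). In the second case the roles of
    u - v and u + v are exchanged, so that the main term 2uv of s is positive in
    both cases. This matters because d is about ue, so that 2|d| may reach the
    order of 2uv; the inequality 2|d| < n + s then only has to win on lower
    order terms. *)
Lemma solvable_of_near_difference_of_squares (u v e : Z) :
  42 <= u -> 0 <= v -> 3 * v <= u -> Z.abs e <= v ->
  Z.Odd (u + v) -> Z.Even e ->
  solvable (u ^ 2 - v ^ 2 - 2 * e).
Proof.
  intros Hu Hv Hvu He [k Hk] [f Hf].
  assert (Hee : 0 <= e * e <= v * v) by nia.
  assert (Huu : 42 * u <= u * u) by nia.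
  assert (Huv : 3 * (u * v) <= u * u) by nia.
  assert (Hvv : 3 * (v * v) <= u * v) by nia.
  destruct (Z.Even_or_Odd u) as [[g Hg] | [g Hg]].
  - assert (Hd : Z.abs ((u - v) * e) <= (u - v) * v)
      by (rewrite Z.abs_mul, (Z.abs_eq (u - v)) by lia;
          apply Z.mul_le_mono_nonneg_l; lia).
    apply solvable_of_ternary with
      (s := 2 * u * v + e ^ 2 - 1) (d := (u - v) * e + (u + v))
      (w := 2 * g ^ 2 + 2 * (k - g) ^ 2 + 2 * (k - g) + 1 + 2 * f ^ 2).
    + replace v with (2 * (k - g) + 1) by lia. subst u e; ring.
    + exists (g ^ 2 - (k - g) ^ 2 - (k - g) - f - 2 * g * (k - g) - g - f ^ 2).
      replace v with (2 * (k - g) + 1) by lia. subst u e; ring.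
    + exists (g ^ 2 - (k - g) ^ 2 + 2 * g * (k - g) + 2 * g + f ^ 2
              + 2 * f * g - 2 * f * (k - g) - 2 * f).
      replace v with (2 * (k - g) + 1) by lia. subst u e; ring.
    + clear Hg Hf Hk; lia.
    + clear Hg Hf Hk; lia.
  - assert (Hd : Z.abs ((u + v) * e) <= (u + v) * v)
      by (rewrite Z.abs_mul, (Z.abs_eq (u + v)) by lia;
          apply Z.mul_le_mono_nonneg_l; lia).
    apply solvable_of_ternary with
      (s := 2 * u * v - e ^ 2 + 1) (d := (u + v) * e + (u - v))
      (w := 2 * g ^ 2 + 2 * g + 1 + 2 * (k - g) ^ 2 + 2 * f ^ 2).
    + replace v with (2 * (k - g)) by lia. subst u e; ring.
    + exists (g ^ 2 + g - (k - g) ^ 2 - f - 2 * g * (k - g) - (k - g) + f ^ 2).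
      replace v with (2 * (k - g)) by lia. subst u e; ring.
    + exists (g ^ 2 + 2 * g - (k - g) ^ 2 + 2 * g * (k - g) - f ^ 2
              + 2 * f * g + 2 * f * (k - g) + 1).
      replace v with (2 * (k - g)) by lia. subst u e; ring.
    + clear Hg Hf Hk; lia.
    + clear Hg Hf Hk; lia.
Qed.

(** If t^2 <= m < (t + 1)^2, one of t and t + 1 has the required parity, and
    m - t^2 <= 2t while (t + 1)^2 - m <= 2t + 1. *)
Lemma near_sqrt_of_parity (m r : Z) :
  0 <= m -> exists v, 0 <= v /\ Z.Even (v - r) /\ Z.abs (m - v ^ 2) <= 2 * v.
Proof.
  intros Hm.
  pose proof (Z.sqrt_nonneg m) as Ht.
  pose proof (Z.sqrt_spec m Hm) as Hs.
  set (t := Z.sqrt m) in *; clearbody t; cbv zeta in Hs.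
  destruct (Z.Even_or_Odd (t - r)) as [H | [q Hq]].
  - exists t. split; [lia | split; [exact H | lia]].
  - exists (t + 1). split; [lia | split; [exists (q + 1); lia | lia]].
Qed.

(** Write n = 2q + 1. The parity of u is that of q + 1, and v has the other one;
    then u^2 - v^2 - n is divisible by 4, which makes e even. *)
Lemma solvable_large_odd (n : Z) : 41 ^ 2 <= n -> Z.Odd n -> solvable n.
Proof.
  intros Hn [q Hq].
  assert (Hu : exists u, 42 <= u /\ Z.Even (u - (q + 1)) /\
                         0 <= u ^ 2 - n <= 4 * u - 4).
  { pose proof (Z.sqrt_spec n ltac:(lia)) as Hs.
    assert (Ht : 41 <= Z.sqrt n) by (apply Z.sqrt_le_square; lia).
    set (t := Z.sqrt n) in *; clearbody t; cbv zeta in Hs.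
    destruct (Z.Even_or_Odd (t - q)) as [[j Hj] | [j Hj]].
    - exists (t + 1). repeat split; [lia | exists j; lia | lia | lia].
    - exists (t + 2). repeat split; [lia | exists (j + 1); lia | lia | lia]. }
  destruct Hu as (u & Hu & [i Hi] & Hun).
  destruct (near_sqrt_of_parity (u ^ 2 - n) q) as (v & Hv & [j Hj] & Hm); [lia |].
  (* As (v - 1)^2 <= 4u - 3, having v > u/3 would give u^2 - 42u + 36 <= 0: this
     is where the threshold 41^2 for n comes from. *)
  assert (Hvu : 3 * v <= u) by nia.
  assert (He : exists f, u ^ 2 - v ^ 2 - n = 4 * f).
  { (* u = 2i + q + 1 and v = 2j + q *)
    exists (i ^ 2 + i * (q + 1) - j ^ 2 - j * q).
    replace u with (2 * i + q + 1) by lia.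
    replace v with (2 * j + q) by lia.
    subst n; ring. }
  destruct He as [f Hf].
  replace n with (u ^ 2 - v ^ 2 - 2 * (2 * f)) by lia.
  apply solvable_of_near_difference_of_squares; try lia.
  - exists (i + j + q); lia.
  - exists f; lia.
Qed.

(** * The finite range *)

Fixpoint some_down (k : nat) (i : Z) (f : Z -> bool) : bool :=
  match k with
  | O => false
  | S k' => if f i then true else some_down k' (i - 1) f
  end.

Lemma some_down_true (k : nat) (i : Z) (f : Z -> bool) :
  some_down k i f = true ->
  exists j, i - Z.of_nat k < j <= i /\ f j = true.
Proof.
  revert i; induction k as [| k IH]; intros i H; [discriminate |].
  cbn [some_down] in H.
  destruct (f i) eqn:Hf.
  - exists i; split; [lia | exact Hf].
  - destruct (IH _ H) as (j & Hj & Hfj). exists j; split; [lia | exact Hfj].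
Qed.

Lemma some_down_false (k : nat) (i : Z) (f : Z -> bool) :
  some_down k i f = false ->
  forall j, i - Z.of_nat k < j <= i -> f j = false.
Proof.
  revert i; induction k as [| k IH]; intros i H j Hj; [lia |].
  cbn [some_down] in H.
  destruct (f i) eqn:Hf; [discriminate |].
  destruct (Z.eq_dec j i) as [-> | Hne]; [exact Hf |].
  apply (IH (i - 1) H); lia.
Qed.

Definition is_square (a : Z) : bool := let r := Z.sqrt a in r * r =? a.

(** The search starts from the balanced solutions, with z near n/4 and x near y,
    because it then stops sooner than when starting from small x and z. *)
Definition has_solution (n : Z) : bool :=
  some_down (Z.to_nat (n / 4)) (n / 4) (fun z =>
    let t := n - 2 * z in
    some_down (Z.to_nat (t / 2)) (t / 2) (fun x =>
      let y := t - x in is_square (x * x + y * y + 2 * (z * z)))).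

Lemma has_solution_sound (n : Z) : 0 < n -> has_solution n = true -> solvable n.
Proof.
  intros Hn H.
  apply some_down_true in H as (z & Hz & H).
  apply some_down_true in H as (x & Hx & H).
  apply Z.eqb_eq in H.
  exists x, (n - 2 * z - x), z.
  assert (0 <= n / 4) by (apply Z.div_pos; lia).
  assert (4 * (n / 4) <= n) by (apply Z.mul_div_le; lia).
  assert (2 * ((n - 2 * z) / 2) <= n - 2 * z) by (apply Z.mul_div_le; lia).
  assert (0 <= (n - 2 * z) / 2) by (apply Z.div_pos; lia).
  split; [lia |]. split; [lia |]. split; [lia |]. split; [lia |].
  set (y := n - 2 * z - x) in *.
  eexists; transitivity (x * x + y * y + 2 * (z * z)); [ring |].
  rewrite Z.pow_2_r; symmetry; exact H.
Qed.

(** The bound 17 < n / p keeps the quotient clear of all exceptional values. *)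
Definition reducible_by (n p : Z) : bool := (n mod p =? 0) && (17 <? n / p).

Definition reducible (n : Z) : bool := existsb (reducible_by n) [2; 3; 5; 7].

Definition exceptional (n : Z) : bool := (n =? 11) || (n =? 14) || (n =? 17).

(** The search is quadratic in n, so it is run only where scaling does not apply. *)
Definition unsettled (n : Z) : bool :=
  if reducible n then false else
  if exceptional n then false else negb (has_solution n).

Lemma no_unsettled_below : some_down (Z.to_nat 1673) 1680 unsettled = false.
Proof. vm_compute. reflexivity. Qed.

Lemma solvable_small (n : Z) :
  7 < n < 41 ^ 2 -> exceptional n = false -> reducible n = true \/ solvable n.
Proof.
  intros Hn He.
  assert (H : unsettled n = false)
    by (apply (some_down_false _ _ _ no_unsettled_below); lia).
  unfold unsettled in H. rewrite He in H.
  destruct (reducible n); [left; reflexivity | right].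
  apply has_solution_sound; [lia |].
  destruct (has_solution n); [reflexivity | discriminate].
Qed.

Lemma reducible_factor (n : Z) :
  reducible n = true -> exists p m, 1 < p /\ 17 < m /\ n = p * m.
Proof.
  intros H. apply existsb_exists in H as (p & Hp & H).
  apply andb_true_iff in H as [H0 Hm].
  apply Z.eqb_eq in H0. apply Z.ltb_lt in Hm.
  assert (1 < p) by (simpl in Hp; lia).
  exists p, (n / p). split; [lia | split; [lia |]].
  apply Z.div_exact; lia.
Qed.

(** * All numbers *)

Theorem theorem1p4 (n : Z) :
  n > 7 -> n <> 11 -> n <> 14 -> n <> 17 ->
  exists x y z : Z,
    x > 0 /\ y > 0 /\ z > 0 /\
    n = x + y + 2 * z /\
    perfect_square (x ^ 2 + y ^ 2 + 2 * z ^ 2).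
Proof.
  intros H7 H11 H14 H17. change (solvable n).
  assert (Hn : 0 <= n) by lia.
  revert n Hn H7 H11 H14 H17.
  apply (Z_lt_induction (fun n =>
    n > 7 -> n <> 11 -> n <> 14 -> n <> 17 -> solvable n)).
  intros n IH H7 H11 H14 H17.
  destruct (Z_lt_ge_dec n (41 ^ 2)) as [Hlt | Hge].
  - assert (He : exceptional n = false) by (unfold exceptional; lia).
    destruct (solvable_small n ltac:(lia) He) as [Hr | Hs]; [| exact Hs].
    apply reducible_factor in Hr as (p & m & Hp & Hm & ->).
    apply solvable_scale; [lia |]. apply IH; nia.
  - destruct (Z.Even_or_Odd n) as [[m ->] | Hodd].
    + apply solvable_scale; [lia |]. apply IH; lia.
    + apply solvable_large_odd; [lia | exact Hodd].
Qed.
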